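(* Let $K\ge1$, let $\mathcal N\subseteq\mathcal K=\{1,\dots,K\}$ be the set of true null indices, $K_0=|\mathcal N|$, and let $\psi$ be a decreasing transform. For arbitrary p-values $P_1,\dots,P_K$ (any dependence), the p-testing procedure $\mathcal D(\psi)$ satisfies $$\mathbb E\left[\frac{F_{\mathcal D(\psi)}}{R_{\mathcal D(\psi)}}\right]\le\frac{K_0}{K}y_\psi,\qquad y_\psi:=\psi^{-1}(1)+\sum_{j=1}^{K-1}\frac{K}{j(j+1)}\psi^{-1}(K/j).$$ If the p-values are PRDS, then $$\mathbb E\left[\frac{F_{\mathcal D(\psi)}}{R_{\mathcal D(\psi)}}\right]\le\frac{K_0}{K}z_\psi,\qquad z_\psi:=\max_{t\in K/\mathcal K}t\,\psi^{-1}(t).$$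
   Context: $K/\mathcal K:=\{K/k:k\in\mathcal K\}$. P-values are $[0,1]$-valued random variables $P_1,\dots,P_K$ such that for every $k\in\mathcal N$, $\mathbb P(P_k\le a)\le a$ for all $a\in(0,1)$. A decreasing transform is a strictly decreasing and continuous function $\psi:[0,1]\to[0,\infty]$ with $\psi(0)=\infty$. Its inverse is understood as $\psi^{-1}(t)=\sup\{p\in[0,1]:\psi(p)\ge t\}$ (the usual inverse when $t$ is in the range of $\psi$, and $1$ when $t<\psi(1)$). The procedure $\mathcal D(\psi)$: with order statistics $p_{(1)}\le\dots\le p_{(K)}$ of the realized p-values, reject the hypotheses with the $k^*_\psi$ smallest p-values, where $k^*_\psi=\max\{k\in\mathcal K:\psi(p_{(k)})\ge K/k\}$, with $\max\varnothing=0$. $R_{\mathcal D}$ is the number of rejections, $F_{\mathcal D}$ the number of rejected indices in $\mathcal N$, and $0/0=0$. PRDS for p-values: a set $A\subseteq\mathbb R^K$ is increasing if $\mathbf x\in A$ and $\mathbf y\ge\mathbf x$ componentwise imply $\mathbf y\in A$. The vector $\mathbf P=(P_1,\dots,P_K)$ is PRDS if for every $k\in\mathcal N$ and every increasing (Borel) set $A\subseteq\mathbb R^K$, the function $x\mapsto\mathbb P(\mathbf P\in A\mid P_k\le x)$ is increasing (non-strictly) on $[0,1]$ (where the conditioning event has positive probability). *)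

(* Defs.v *)
From HB Require Import structures.
From mathcomp Require Import all_boot all_order all_algebra.
From mathcomp Require Import all_classical all_reals all_analysis.

Set Implicit Arguments.
Unset Strict Implicit.
Unset Printing Implicit Defensive.

Import Order.TTheory GRing.Theory Num.Theory.
Import numFieldNormedType.Exports.

Local Open Scope classical_set_scope.
Local Open Scope ring_scope.

(* The K hypotheses are indexed by 'I_K; ranks and critical indices k are
   natural numbers with 1 <= k <= K. *)

Section Transform.
Context {R : realType}.

(* psi is a total function on R, but only its restriction to [0, 1] is
   constrained or used. *)
Definition decreasing_transform (psi : R -> \bar R) : Prop :=
  [/\ forall p : R, 0 <= p <= 1 -> (0 <= psi p)%E,
      forall p q : R, 0 <= p -> p < q -> q <= 1 -> (psi q < psi p)%E,
      {within [set` `[0, 1]], continuous psi}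
    & psi 0 = +oo%E].

Definition psi_inv (psi : R -> \bar R) (t : \bar R) : R :=
  sup [set p : R | 0 <= p <= 1 /\ (t <= psi p)%E].

Definition y_psi (K : nat) (psi : R -> \bar R) : R :=
  psi_inv psi 1%:E +
  \sum_(1 <= j < K) K%:R / (j%:R * j.+1%:R) * psi_inv psi (K%:R / j%:R)%:E.

(* All the values are nonnegative, so for K >= 1 the default value 0 does not
   affect the maximum. *)
Definition z_psi (K : nat) (psi : R -> \bar R) : R :=
  \big[Num.max/0]_(1 <= k < K.+1)
    (K%:R / k%:R * psi_inv psi (K%:R / k%:R)%:E).

End Transform.

Section Procedure.
Context {R : realType} {K : nat}.
Implicit Types (psi : R -> \bar R) (p : 'I_K -> R).

(* The k-th smallest value of p, for 1 <= k <= K. *)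
Definition order_stat p (k : nat) : R := nth 0 (sort <=%R (codom p)) k.-1.

Definition kstar psi p : nat :=
  \max_(1 <= k < K.+1 | ((K%:R / k%:R)%:E <= psi (order_stat p k))%E) k.

(* Ties are broken by index. For psi decreasing this choice is immaterial: by
   maximality of k*, the k*-th and (k*+1)-th order statistics differ. *)
Definition rejected psi p : {set 'I_K} :=
  [set i in take (kstar psi p) (sort (fun i j => p i <= p j) (enum 'I_K))]%SET.

Definition num_rejected psi p : nat := #|rejected psi p|.

Definition num_false psi (N : {set 'I_K}) p : nat :=
  #|(rejected psi p :&: N)%SET|.

(* Division by zero is zero in R, which gives the convention 0 / 0 = 0. *)
Definition FDP psi (N : {set 'I_K}) p : R :=
  (num_false psi N p)%:R / (num_rejected psi p)%:R.

End Procedure.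

Section PValues.
Context {d : measure_display} {T : measurableType d} {R : realType}.
Context (P : probability T R) {K : nat}.
Implicit Types (N : {set 'I_K}) (X : 'I_K -> {RV P >-> R}).

Definition p_values N X : Prop :=
  (forall k w, 0 <= X k w <= 1) /\
  (forall k, k \in N -> forall a : R, 0 < a < 1 ->
     (P [set w | (X k w <= a)%R] <= a%:E)%E).

Definition cond_prob (A B : set T) : R := fine (P (A `&` B)) / fine (P B).

Definition increasing_set (A : set (K.-tuple R)) : Prop :=
  forall x y, A x -> (forall i, tnth x i <= tnth y i) -> A y.

(* The canonical sigma-algebra on K.-tuple R is generated by the coordinates,
   i.e. it is the Borel sigma-algebra of R^K. *)
Definition PRDS N X : Prop :=
  forall k, k \in N ->
  forall A : set (K.-tuple R), measurable A -> increasing_set A ->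
  forall x y : R, 0 <= x -> x <= y -> y <= 1 ->
    (0 < P [set w | (X k w <= x)%R])%E ->
    cond_prob [set w | A [tuple X i w | i < K]] [set w | X k w <= x]
    <= cond_prob [set w | A [tuple X i w | i < K]] [set w | X k w <= y].

End PValues.

(* Main.v *)
(** Write a_k for the inverse of psi at K/k, and k* for the number of rejections.
    A rejected p-value is at most a_k*, so the false discovery proportion is at
    most the sum over true nulls i of 1{P_i <= a_k*} / k*.

    Under any dependence, 1/k* is the sum over k* <= j <= K of the weights
    1/(j(j+1)) for j < K and 1/K for j = K. As a_k* <= a_j for these j, the i-th
    term is at most the weighted sum of the indicators of P_i <= a_j.

    Under PRDS, the i-th term has expectation the sum over k of
    P(k* = k, P_i <= a_k) / k, and P(P_i <= a_k) / k <= a_k / k <= z / K. The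
    remaining factor P(k* <= k | P_i <= a_k) - P(k* <= k-1 | P_i <= a_k) is at most
    P(k* <= k | P_i <= a_k) - P(k* <= k-1 | P_i <= a_(k-1)), because k* <= k-1 is an
    increasing event in the p-values, and the latter differences telescope to at
    most 1. *)

Require Import Defs.
From mathcomp Require Import all_boot all_order all_algebra.
From mathcomp Require Import all_classical all_reals all_analysis.
From mathcomp Require Import measurable_realfun ring.
Import Order.TTheory GRing.Theory Num.Theory.
Import numFieldNormedType.Exports.

Set Implicit Arguments.
Unset Strict Implicit.
Unset Printing Implicit Defensive.

Local Open Scope classical_set_scope.
Local Open Scope ring_scope.

(** * The generalized inverse of a decreasing transform *)

Section TransformInverse.
Context {R : realType} (psi : R -> \bar R).
Hypothesis psi_dec : decreasing_transform psi.

Let superlevel (t : \bar R) : set R :=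
  [set p | 0 <= p <= 1 /\ (t <= psi p)%E].

Lemma has_sup_superlevel t : has_sup (superlevel t).
Proof.
have [_ _ _ psi0] := psi_dec; split; last by exists 1 => p [/andP[]].
by exists 0; rewrite /superlevel /= lexx ler01 psi0 leey.
Qed.

Lemma psi_inv_itv t : 0 <= psi_inv psi t <= 1.
Proof.
have [_ _ _ psi0] := psi_dec; have hs := has_sup_superlevel t.
apply/andP; split.
  apply: (ub_le_sup hs.2); rewrite /superlevel /= lexx ler01 psi0.
  by rewrite leey.
by apply: ge_sup; [exact: hs.1|move=> p [/andP[]]].
Qed.

(** This Galois connection removes [psi] from the procedure: threshold conditions on [psi] become
    comparisons of p-values with critical values. *)
Lemma le_psi_inv t q : 0 <= q <= 1 ->
  (t <= psi q)%E = (q <= psi_inv psi t).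
Proof.
have [_ psi_decr psi_cont psi0] := psi_dec; have hs := has_sup_superlevel t.
move=> q01; apply/idP/idP => [tq|qa]; first exact: (ub_le_sup hs.2).
have /andP[a0 a1] := psi_inv_itv t.
(* The supremum defining the inverse is attained, by continuity. *)
suff ta : (t <= psi (psi_inv psi t))%E.
  move: qa; rewrite le_eqVlt => /orP[/eqP ->//|qa].
  apply: le_trans ta (ltW _); apply: psi_decr => //; first by case/andP: q01.
(* Otherwise [psi] stays below [t] near the supremum, yet points of the superlevel set lie
   arbitrarily close to it. *)
rewrite leNgt; apply/negP => at_.
have /= := (subspace_continuousP _ _).1 psi_cont (psi_inv psi t).
rewrite in_itv /= a0 a1 => /(_ isT) /(_ _ (open_ereal_lt' at_)).
rewrite /nbhs /= /within /= => -[e /= e0 He].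
have [p [p01 tp] ap] := sup_adherent e0 hs.
have pa : p <= psi_inv psi t by exact: (ub_le_sup hs.2).
have /= : `|psi_inv psi t - p| < e.
  by rewrite ger0_norm ?subr_ge0// ltrBlDl -ltrBlDr.
move/He => /=; rewrite in_itv /= => /(_ p01).
by rewrite ltNge tp.
Qed.

Lemma psi_inv_mono t u : (t <= u)%E -> psi_inv psi u <= psi_inv psi t.
Proof.
move=> tu; rewrite -le_psi_inv ?psi_inv_itv//; apply: le_trans tu _.
by rewrite le_psi_inv ?psi_inv_itv.
Qed.

End TransformInverse.

(** * The step-up rule in terms of counts of p-values below critical values *)

Section StepUp.
Context {R : realType} {K : nat} (psi : R -> \bar R).
Hypothesis psi_dec : decreasing_transform psi.
Implicit Types (p : 'I_K -> R) (N : {set 'I_K}).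

Definition num_below p (a : R) : nat := #|[set i | p i <= a]%SET|.

Definition crit (k : nat) : R := psi_inv psi (K%:R / k%:R)%:E.

Lemma crit_ge0 k : 0 <= crit k.
Proof. by case/andP: (psi_inv_itv psi_dec (K%:R / k%:R)%:E). Qed.

Lemma crit_le1 k : crit k <= 1.
Proof. by case/andP: (psi_inv_itv psi_dec (K%:R / k%:R)%:E). Qed.

(** Rank 0 is excluded: as [x / 0 = 0], [crit 0] is the inverse at 0, which is 1. *)
Lemma crit_mono j k : (0 < j)%N -> (j <= k)%N -> crit j <= crit k.
Proof.
move=> j0 jk; apply: psi_inv_mono => //; rewrite lee_fin ler_wpM2l//.
by rewrite lef_pV2 ?posrE ?ltr0n ?ler_nat// (leq_trans j0).
Qed.

(** In the sorted list the entries at most [a] form a prefix of length [num_below p a]. *)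
Lemma order_stat_le p a k : (0 < k <= K)%N ->
  (order_stat p k <= a) = (k <= num_below p a)%N.
Proof.
case: k => // k /= kK.
have -> : num_below p a = count (<= a) (sort <=%R (codom p)).
  rewrite /num_below cardsE cardE /enum_mem size_filter count_sort codomE.
  by rewrite count_map enumT.
have ss : sorted <=%O (sort <=%R (codom p)) by exact/sort_le_sorted.
have sz : size (sort <=%R (codom p)) = K by rewrite size_sort size_codom card_ord.
rewrite /order_stat /=; apply/idP/idP => [h|h]; last exact: nth_count_le.
rewrite ltnNge; apply/negP => h'.
have := @nth_count_gt _ _ a 0 _ k ss; rewrite h' sz kK => /(_ isT).
by rewrite ltNge h.
Qed.

Lemma order_stat_itv p k : (forall i, 0 <= p i <= 1) -> (0 < k <= K)%N ->
  0 <= order_stat p k <= 1.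
Proof.
move=> p01 /andP[k0 kK]; rewrite /order_stat.
have : nth 0 (sort <=%R (codom p)) k.-1 \in sort <=%R (codom p).
  by rewrite mem_nth// size_sort size_codom card_ord prednK.
by rewrite mem_sort => /codomP[i ->].
Qed.

Lemma le_psi_order_stat p k : (forall i, 0 <= p i <= 1) -> (0 < k <= K)%N ->
  ((K%:R / k%:R)%:E <= psi (order_stat p k))%E = (k <= num_below p (crit k))%N.
Proof.
by move=> p01 kK; rewrite le_psi_inv// ?order_stat_itv// order_stat_le.
Qed.

Lemma kstarE p : (forall i, 0 <= p i <= 1) ->
  kstar psi p = (\max_(1 <= k < K.+1 | (k <= num_below p (crit k))%N) k)%N.
Proof.
move=> p01; rewrite /kstar big_nat_cond [RHS]big_nat_cond.
apply: eq_bigl => k; apply: andb_id2l => kK.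
by rewrite le_psi_order_stat.
Qed.

Lemma kstar_leq p : (kstar psi p <= K)%N.
Proof.
by apply/bigmax_leqP_seq => k; rewrite mem_index_iota ltnS => /andP[].
Qed.

(** The counts on the right can only drop when p-values grow; this form gives both measurability and
    monotonicity of the event. *)
Lemma kstar_leP p j : (forall i, 0 <= p i <= 1) ->
  (kstar psi p <= j)%N <->
  (forall k, (j < k <= K)%N -> (num_below p (crit k) < k)%N).
Proof.
move=> p01; rewrite kstarE//; split.
  move=> /bigmax_leqP_seq h k /andP[jk kK]; rewrite ltnNge; apply/negP => hk.
  have /(_ _ hk) := h k; rewrite mem_index_iota ltnS kK (leq_trans _ jk)//.
  by move/(_ isT); rewrite leqNgt jk.
move=> h; apply/bigmax_leqP_seq => k; rewrite mem_index_iota ltnS => /andP[_ kK] hk.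
rewrite leqNgt; apply/negP => jk; move: (h k).
by rewrite jk kK ltnNge hk => /(_ isT).
Qed.

(** The maximum is attained: if the condition failed at [kstar] itself, [kstar] would be at most its
    predecessor. *)
Lemma kstar_num_below p : (forall i, 0 <= p i <= 1) -> (0 < kstar psi p)%N ->
  (kstar psi p <= num_below p (crit (kstar psi p)))%N.
Proof.
move=> p01 k0; rewrite leqNgt; apply/negP => h.
suff : (kstar psi p <= (kstar psi p).-1)%N by rewrite -ltnS prednK// ltnn.
apply/kstar_leP => // k; rewrite prednK// => /andP[].
rewrite leq_eqVlt => /orP[/eqP <-//|kk kK].
by apply: ((kstar_leP (kstar psi p) p01).1 (leqnn _)); rewrite kk kK.
Qed.

(** A rejected index is among the first [kstar] of the indices sorted by [p], so [p i] is at most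
    the order statistic of rank [kstar]. *)
Lemma rejectedP p i : (forall i, 0 <= p i <= 1) -> i \in rejected psi p ->
  (0 < kstar psi p)%N /\ p i <= crit (kstar psi p).
Proof.
move=> p01; rewrite inE; set s := sort _ _ => /index_ltn ik.
have k0 := leq_ltn_trans (leq0n _) ik.
split => //; have := kstar_num_below p01 k0; rewrite -order_stat_le ?k0 ?kstar_leq//.
apply: le_trans.
have sE : [seq p i | i <- s] = sort <=%R (codom p).
  by rewrite codomE /s (map_sort (leT := <=%R)).
have sz : size s = K by rewrite size_sort -cardE card_ord.
have iS : i \in s by rewrite mem_sort mem_enum.
have := index_mem i s; rewrite iS sz => iK.
have -> : p i = nth 0 (sort <=%R (codom p)) (index i s).
  by rewrite -sE (nth_map i) ?nth_index// sz.
apply: (sorted_leq_nth le_trans le_refl) => //.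
- exact: sort_le_sorted.
- by rewrite inE size_sort size_codom card_ord.
- by rewrite inE size_sort size_codom card_ord prednK// kstar_leq.
- by rewrite -ltnS prednK.
Qed.

Lemma num_rejectedE p : num_rejected psi p = kstar psi p.
Proof.
rewrite /num_rejected /rejected cardsE; set s := sort _ _.
have /card_uniqP -> : uniq (take (kstar psi p) s).
  by rewrite take_uniq// sort_uniq enum_uniq.
by rewrite size_takel// size_sort -cardE card_ord kstar_leq.
Qed.

Lemma FDP_ge0 N p : 0 <= FDP psi N p.
Proof. by rewrite divr_ge0. Qed.

Lemma FDP_le N p : (forall i, 0 <= p i <= 1) ->
  FDP psi N p <= \sum_(i in N)
    ((0 < kstar psi p)%N && (p i <= crit (kstar psi p)))%:R / (kstar psi p)%:R.
Proof.
move=> p01; rewrite /FDP num_rejectedE -mulr_suml ler_wpM2r// -natr_sum ler_nat.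
rewrite /num_false -sum1_card big_mkcond [leqRHS]big_mkcond /=.
apply: leq_sum => i _; rewrite inE; case: (i \in N); rewrite ?andbT ?andbF//.
by case: ifP => // /(rejectedP p01)[-> ->].
Qed.

End StepUp.

(** * Expectations bounded by probabilities, and conditional probabilities *)

Section Expectation.
Context {d : measure_display} {T : measurableType d} {R : realType}.
Context (P : probability T R).

(* No measurability of [f] is needed, because its integral is the supremum of
   the integrals of the simple functions below it. *)
Lemma expectation_le_sum_indic (I : Type) (s : seq I) (f : T -> R)
    (c : I -> R) (B : I -> set T) :
  (forall w, 0 <= f w) -> (forall k, 0 <= c k) ->
  (forall k, measurable (B k)) ->
  (forall w, f w <= \sum_(k <- s) c k * \1_(B k) w) ->
  ('E_P[f] <= (\sum_(k <- s) c k * fine (P (B k)))%:E)%E.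
Proof.
move=> f0 c0 mB fle; rewrite unlock.
have g0 w : 0 <= \sum_(k <- s) c k * \1_(B k) w.
  by rewrite sumr_ge0// => k _; rewrite mulr_ge0.
apply: (@le_trans _ _ (\int[P]_w (\sum_(k <- s) c k * \1_(B k) w)%:E)%E).
  rewrite !ge0_integralTE; try by move=> w; rewrite lee_fin.
  apply: ereal_sup_le => _ [h hf <-]; exists h => // w.
  by apply: le_trans (hf w) _; rewrite lee_fin.
have -> : (fun w => (\sum_(k <- s) c k * \1_(B k) w)%:E) =
    (fun w => \sum_(k <- s) (c k * \1_(B k) w)%:E)%E.
  by apply/funext => w; rewrite sumEFin.
rewrite ge0_integral_sum//=; last 2 first.
- move=> k; apply/measurable_EFinP; apply: measurable_funM; first exact: measurable_cst.
  exact: measurable_indic.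
- by move=> k w _; rewrite lee_fin mulr_ge0.
rewrite -sumEFin; apply: lee_sum => k _.
have -> : (fun w => (c k * \1_(B k) w)%:E) =
    (fun w => (c k)%:E * (\1_(B k) w)%:E)%E.
  by apply/funext => w; rewrite EFinM.
rewrite ge0_integralZl//=; last 2 first.
- by apply/measurable_EFinP; exact: measurable_indic.
- by rewrite lee_fin.
by rewrite integral_indic// setIT EFinM fineK// fin_num_measure.
Qed.

Lemma fine_probability_le (A B : set T) : measurable A -> measurable B ->
  A `<=` B -> fine (P A) <= fine (P B).
Proof.
move=> mA mB AB; apply: fine_le; rewrite ?fin_num_measure//.
by apply: le_measure => //; rewrite inE.
Qed.

Lemma cond_prob_ge0 (A B : set T) : 0 <= cond_prob P A B.
Proof. by rewrite divr_ge0// fine_ge0. Qed.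

Lemma cond_prob_le1 (A B : set T) : measurable A -> measurable B ->
  cond_prob P A B <= 1.
Proof.
move=> mA mB; have := fine_ge0 (measure_ge0 P B).
rewrite /cond_prob le_eqVlt => /orP[/eqP <-|B0]; first by rewrite invr0 mulr0.
by rewrite ler_pdivrMr// mul1r fine_probability_le//; exact: measurableI.
Qed.

(** For null [B] both sides vanish, since the intersection is null too. *)
Lemma cond_probK (A B : set T) : measurable A -> measurable B ->
  cond_prob P A B * fine (P B) = fine (P (A `&` B)).
Proof.
move=> mA mB; have [B0|B0] := eqVneq (fine (P B)) 0; last by rewrite mulfVK.
rewrite B0 mulr0; apply/esym/eqP; rewrite eq_le fine_ge0// andbT -B0.
by apply: fine_probability_le => //; exact: measurableI.
Qed.

End Expectation.

(** * Sublevel events of null p-values, endpoints included *)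

Section PValueBounds.
Context {d : measure_display} {T : measurableType d} {R : realType}.
Context (P : probability T R) {K : nat} (N : {set 'I_K}).
Context (X : 'I_K -> {RV P >-> R}).

Lemma measurable_sublevel i (a : R) : measurable [set w | X i w <= a].
Proof.
rewrite (_ : [set w | _] = setT `&` X i @^-1` `]-oo, a]%classic); last first.
  by rewrite setTI; apply/seteqP; split => w /=; rewrite in_itv.
exact: measurable_funPT.
Qed.

Hypothesis X_pval : p_values N X.

Lemma p_value_sublevel i (a : R) : i \in N -> 0 <= a <= 1 ->
  fine (P [set w | X i w <= a]) <= a.
Proof.
move=> iN /andP[a0 a1]; have [_ Xsub] := X_pval.
(* The hypothesis covers only levels strictly between 0 and 1; the slack [e] reaches level 0 from
   above, and levels from 1 on are trivial. *)
have bnd e : 0 < e -> fine (P [set w | X i w <= a]) <= a + e.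
  move=> e0; have [e1|e1] := ltP (a + e) 1; last first.
    apply: le_trans e1; rewrite -lee_fin fineK ?fin_num_measure//.
      exact: probability_le1 (measurable_sublevel i a).
    exact: measurable_sublevel.
  apply: (@le_trans _ _ (fine (P [set w | X i w <= a + e]))).
    apply: fine_probability_le; [exact: measurable_sublevel..|].
    by move=> w /= /le_trans; apply; rewrite lerDl ltW.
  rewrite -lee_fin fineK; last by rewrite fin_num_measure//; exact: measurable_sublevel.
  by apply: Xsub => //; rewrite e1 andbT ltr_wpDl.
by apply/ler_addgt0Pr.
Qed.

End PValueBounds.

(** * Events determined by the number of rejections *)

Section ProcedureEvents.
Context {d : measure_display} {T : measurableType d} {R : realType}.
Context (P : probability T R) {K : nat} (N : {set 'I_K}).
Context (X : 'I_K -> {RV P >-> R}) (psi : R -> \bar R).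
Hypothesis psi_dec : decreasing_transform psi.
Hypothesis X_pval : p_values N X.

Local Notation ks w := (kstar psi (X^~ w)).
Local Notation a := (@crit R K psi).

Let X01 w i : 0 <= X i w <= 1.
Proof. by case: X_pval => X01 _; exact: X01. Qed.

Definition few_below (k : nat) (b : R) : set (K.-tuple R) :=
  [set x | (num_below (tnth x) b < k)%N].

Lemma measurable_few_below k b : measurable (few_below k b).
Proof.
(* A finite union: [S] stands for a set of fewer than [k] indices containing all coordinates at most
   [b]. *)
have -> : few_below k b =
    \bigcup_(S in [set S : {set 'I_K} | (#|S| < k)%N])
      \bigcap_(i in [set i | i \notin S]) [set x : K.-tuple R | b < tnth x i].
  apply/seteqP; split => x; rewrite /few_below /=.
    move=> h; exists [set i | tnth x i <= b]%SET => //= i.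
    by move/negP; rewrite inE => /negP; rewrite -ltNge.
  move=> [S /= Sk h]; apply: leq_ltn_trans Sk; apply: subset_leq_card.
  apply/fintype.subsetP => i; rewrite inE; apply: contraLR => iS.
  by rewrite -ltNge; exact: h.
apply: fin_bigcup_measurable => // S _.
apply: fin_bigcap_measurable => // i _.
rewrite (_ : [set x | _] = setT `&` (@tnth K R)^~ i @^-1` `]b, +oo[%classic).
  exact: measurable_tnth.
by rewrite setTI; apply/seteqP; split => x /=; rewrite in_itv /= andbT.
Qed.

(** The event that [kstar] is at most [j], encoded as a set of vectors because PRDS quantifies over
    such sets. *)
Definition kstar_event (j : nat) : set (K.-tuple R) :=
  \bigcap_(k in [set k | (j < k <= K)%N]) few_below k (a k).

Lemma measurable_kstar_event j : measurable (kstar_event j).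
Proof.
by apply: bigcap_measurableType => k _; exact: measurable_few_below.
Qed.

Lemma increasing_kstar_event j : increasing_set (kstar_event j).
Proof.
move=> x y Ax xy k jk; apply: leq_ltn_trans (Ax k jk).
apply: subset_leq_card; apply/fintype.subsetP => i; rewrite !inE.
exact: le_trans (xy i).
Qed.

Lemma kstar_eventE j :
  [set w | kstar_event j [tuple X i w | i < K]] = [set w | (ks w <= j)%N].
Proof.
have nE w b : num_below (tnth [tuple X i w | i < K]) b = num_below (X^~ w) b.
  by rewrite (_ : tnth _ = X^~ w)//; apply/funext => i; rewrite tnth_mktuple.
apply/seteqP; split => w /= h.
  apply/kstar_leP => // k jk.
  by rewrite -nE; exact: h.
by move=> k jk; rewrite /few_below /= nE; exact: (kstar_leP psi_dec j (X01 w)).1.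
Qed.

Lemma measurable_kstar_le j : measurable [set w | (ks w <= j)%N].
Proof.
rewrite -kstar_eventE -[X in measurable X]setTI.
apply: (measurable_fun_tnthP _).2 => // [i|]; last exact: measurable_kstar_event.
apply: eq_measurable_fun (measurable_funPT (X i)) => w _ /=.
by rewrite tnth_mktuple.
Qed.

(** Shared by both bounds, which then differ only in the pathwise estimate of a single term. *)
Lemma expectation_FDP_le (c : nat -> R) (B : 'I_K -> nat -> set T) :
  (forall j, 0 <= c j) -> (forall i j, measurable (B i j)) ->
  (forall i w, ((0 < ks w)%N && (X i w <= a (ks w)))%:R / (ks w)%:R <=
    \sum_(1 <= j < K.+1) c j * \1_(B i j) w) ->
  ('E_P[fun w => FDP psi N (fun k => X k w)] <=
    (\sum_(i in N) \sum_(1 <= j < K.+1) c j * fine (P (B i j)))%:E)%E.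
Proof.
move=> c0 mB le.
pose s := [seq (i, j) | i <- enum N, j <- index_iota 1 K.+1].
have -> : \sum_(i in N) \sum_(1 <= j < K.+1) c j * fine (P (B i j)) =
    \sum_(k <- s) c k.2 * fine (P (B k.1 k.2)).
  by rewrite big_allpairs_dep /= big_enum.
apply: expectation_le_sum_indic => //= w; first exact: FDP_ge0.
apply: le_trans (FDP_le psi_dec N (X01 w)) _.
by rewrite big_allpairs_dep /= big_enum; apply: ler_sum => i _; exact: le.
Qed.

(** * The bound under arbitrary dependence *)

Section AnyDependence.

(** The weight 1/(j(j+1)) is kept as a difference so that tail sums telescope; the last weight is
    the remainder. *)
Definition step_weight (j : nat) : R :=
  if j == K then K%:R^-1 else j%:R^-1 - j.+1%:R^-1.

Lemma sum_step_weight k : (k <= K)%N ->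
  \sum_(k <= j < K.+1) step_weight j = k%:R^-1.
Proof.
move=> kK; rewrite big_nat_recr//= {2}/step_weight eqxx.
rewrite (eq_big_nat _ _ (F2 := fun j => - j.+1%:R^-1 - - j%:R^-1)); last first.
  by move=> j /andP[_ jK]; rewrite /step_weight ltn_eqF// opprK addrC.
by rewrite telescope_sumr// opprK addrAC addNr add0r.
Qed.

Lemma step_weight_ge0 j : (0 < j)%N -> 0 <= step_weight j.
Proof.
move=> j0; rewrite /step_weight; case: ifP => _; first by rewrite invr_ge0.
by rewrite subr_ge0 lef_pV2 ?posrE ?ltr0n// ler_nat.
Qed.

Lemma sum_step_weight_crit : (0 < K)%N ->
  \sum_(1 <= j < K.+1) step_weight j * a j = y_psi K psi / K%:R.
Proof.
move=> K0; rewrite big_nat_recr//= {2}/step_weight eqxx /crit divff ?pnatr_eq0 -?lt0n//.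
rewrite /y_psi mulrDl mulr_suml addrC [X in X + _]mulrC; congr (_ + _).
apply: eq_big_nat => j /andP[j0 jK].
rewrite /step_weight ltn_eqF// mulrAC; congr (_ * _).
have jN0 : (j%:R : R) != 0 by rewrite pnatr_eq0 -lt0n.
have jS0 : (j.+1%:R : R) != 0 by rewrite pnatr_eq0.
have KN0 : (K%:R : R) != 0 by rewrite pnatr_eq0 -lt0n.
rewrite mulrAC divff// mul1r -[in X in X - _](divff jS0) -natr1.
by rewrite -natr1 in jS0; field; rewrite jN0 jS0.
Qed.

(** The absolute value supplies weights nonnegative at every index: for positive [K],
    [step_weight 0] is -1. *)
Lemma FDP_term_le_step_weight i w :
  ((0 < ks w)%N && (X i w <= a (ks w)))%:R / (ks w)%:R <=
    \sum_(1 <= j < K.+1) `|step_weight j| * \1_[set w | X i w <= a j] w.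
Proof.
have S0 (m n : nat) : 0 <= \sum_(m <= j < n) `|step_weight j| *
    \1_[set w | X i w <= a j] w.
  by rewrite sumr_ge0// => j _; rewrite mulr_ge0.
have [/andP[k0 ik]|_] := boolP (_ && _); last by rewrite mul0r.
have kK : (ks w <= K)%N := kstar_leq _ _.
(* Ranks below [ks w] contribute a nonnegative amount; from [ks w] on all indicators are 1 and the
   weights sum to the inverse of [ks w]. *)
rewrite (@big_cat_nat _ _ _ (ks w))//=; last exact: leqW.
rewrite -[leLHS]add0r mul1r lerD// -sum_step_weight//.
apply: ler_sum_nat => j /andP[kj jK].
rewrite indicE mem_set /= ?mulr1 ?ler_norm//.
exact: le_trans ik (crit_mono psi_dec k0 kj).
Qed.

Lemma expectation_FDP_le_y_psi : (0 < K)%N ->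
  ('E_P[fun w => FDP psi N (fun k => X k w)]
     <= (#|N|%:R / K%:R * y_psi K psi)%:E)%E.
Proof.
move=> K0; apply: le_trans (expectation_FDP_le _ _ FDP_term_le_step_weight) _ => //.
  by move=> i j; exact: measurable_sublevel.
rewrite lee_fin -mulrA [_^-1 * _]mulrC -sum_step_weight_crit// mulr_natl -sumr_const.
apply: ler_sum => i iN; apply: ler_sum_nat => j /andP[j0 _].
rewrite ger0_norm ?step_weight_ge0// ler_wpM2l ?step_weight_ge0//.
by apply: (p_value_sublevel X_pval) => //; rewrite crit_ge0 ?crit_le1.
Qed.

End AnyDependence.

(** * The bound under PRDS *)

Section PositiveDependence.
Hypothesis X_prds : PRDS N X.

Local Notation below i j := [set w | X i w <= a j].
Local Notation kle j := [set w | (ks w <= j)%N].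

Lemma z_psi_ge0 : 0 <= z_psi K psi.
Proof.
by rewrite /z_psi; elim/big_rec: _ => // k x _ x0; rewrite le_max x0 orbT.
Qed.

Lemma crit_le_z_psi j : (0 < j <= K)%N -> a j / j%:R <= z_psi K psi / K%:R.
Proof.
move=> /andP[j0 jK].
rewrite ler_pdivlMr ?ltr0n ?(leq_trans j0)// [leLHS]mulrC mulrCA [leLHS]mulrC.
apply: (le_bigmax_seq _ j _ (fun k => K%:R / k%:R * a k)) => //.
by rewrite mem_index_iota j0 ltnS.
Qed.

(** The telescoping sequence. It starts at 0 by convention, because [crit 0] is 1 and need not be
    below [crit 1]. *)
Let g i j : R := if j is 0%N then 0 else cond_prob P (kle j) (below i j).

Let mkle j : measurable (kle j). Proof. exact: measurable_kstar_le. Qed.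
Let mbelow i j : measurable (below i j). Proof. exact: measurable_sublevel. Qed.

Lemma cond_prob_kle_mono i j : i \in N -> (0 < fine (P (below i j.+1))) ->
  g i j <= cond_prob P (kle j) (below i j.+1).
Proof.
move=> iN; rewrite /g; case: j => [|j] Pj; first exact: cond_prob_ge0.
have := fine_ge0 (measure_ge0 P (below i j.+1)).
(* PRDS requires the smaller conditioning event to have positive probability; if it is null, the
   left side is 0 because [x / 0 = 0]. *)
rewrite le_eqVlt => /orP[/eqP P0|P0].
  by rewrite {1}/cond_prob -P0 invr0 mulr0 cond_prob_ge0.
rewrite -kstar_eventE; apply: X_prds => //.
- exact: measurable_kstar_event.
- exact: increasing_kstar_event.
- exact: crit_ge0.
- exact: crit_mono.
- exact: crit_le1.
- by move: P0; rewrite -lte_fin fineK// fin_num_measure.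
Qed.

Lemma prob_kstar_eq_le i j : i \in N -> (j < K)%N ->
  j.+1%:R^-1 * fine (P ((kle j.+1 `\` kle j) `&` below i j.+1)) <=
  z_psi K psi / K%:R * (g i j.+1 - g i j).
Proof.
move=> iN jK; set q := fine (P (below i j.+1)).
have zK : 0 <= z_psi K psi / K%:R by rewrite divr_ge0// z_psi_ge0.
have q0 : 0 <= q by exact: fine_ge0.
have -> : (kle j.+1 `\` kle j) `&` below i j.+1 =
    (kle j.+1 `&` below i j.+1) `\` (kle j `&` below i j.+1).
  apply/seteqP; split => w /=.
    by move=> [[kj1 kj] bi]; split => // -[].
  by move=> [[kj1 bi] kj]; split => //; split => // kj'; exact: kj.
have sub : kle j `&` below i j.+1 `<=` kle j.+1 `&` below i j.+1.
  by move=> w /= [kj bi]; split => //; exact: leqW.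
have mA : measurable (kle j.+1 `&` below i j.+1) by exact: measurableI.
have mB : measurable (kle j `&` below i j.+1) by exact: measurableI.
rewrite measureD//; last by rewrite ltey_eq fin_num_measure.
rewrite (setIidr sub) fineB ?fin_num_measure// -!cond_probK// -/q -mulrBl.
(* The sign of this factor allows multiplying it into the bound [qz], before PRDS enlarges it to a
   difference of values of [g]. *)
have D0 : 0 <= cond_prob P (kle j.+1) (below i j.+1) -
    cond_prob P (kle j) (below i j.+1).
  rewrite subr_ge0 /cond_prob ler_wpM2r ?invr_ge0//.
  exact: fine_probability_le.
have qz : j.+1%:R^-1 * q <= z_psi K psi / K%:R.
  apply: le_trans _ (@crit_le_z_psi j.+1 _); last by rewrite jK.
  rewrite mulrC ler_wpM2r//; apply: (p_value_sublevel X_pval) => //.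
  by rewrite crit_ge0 ?crit_le1.
move: q0; rewrite le_eqVlt => /orP[/eqP qE|q0]; last first.
  rewrite mulrCA mulrC; apply: le_trans (ler_wpM2r D0 qz) _.
  by rewrite ler_wpM2l// lerB// cond_prob_kle_mono.
(* Both conditional probabilities are [x / 0 = 0]. *)
rewrite -qE !mulr0 mulr_ge0// subr_ge0 [leRHS]/g.
case: j => [|j] in jK q qE sub mA mB D0 qz *; first exact: cond_prob_ge0.
have P0 : fine (P (below i j.+1)) = 0.
  apply/eqP; rewrite eq_le fine_ge0// andbT qE; apply: fine_probability_le => //.
  by move=> w /= /le_trans; apply; exact: crit_mono.
by rewrite /g {1}/cond_prob P0 invr0 mulr0 cond_prob_ge0.
Qed.

Lemma FDP_term_le_kstar_eq i w :
  ((0 < ks w)%N && (X i w <= a (ks w)))%:R / (ks w)%:R <=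
    \sum_(1 <= j < K.+1) (j%:R : R)^-1 *
      \1_((kle j `\` kle j.-1) `&` below i j) w.
Proof.
have [/andP[k0 ik]|_] := boolP (_ && _); last first.
  by rewrite mul0r sumr_ge0// => j _; rewrite mulr_ge0.
(* The summand at [ks w] alone gives the bound, since [kle j] minus [kle j.-1] is the event that
   [kstar] equals [j]. *)
rewrite (bigD1_seq (ks w)) ?iota_uniq ?mem_index_iota ?k0 ?ltnS ?kstar_leq//=.
rewrite indicE mem_set /= ?mulr1 ?mul1r; last first.
  by split=> //; split=> //; apply/negP; rewrite -ltnNge prednK.
by rewrite lerDl sumr_ge0// => j _; rewrite mulr_ge0.
Qed.

Lemma expectation_FDP_le_z_psi :
  ('E_P[fun w => FDP psi N (fun k => X k w)]
     <= (#|N|%:R / K%:R * z_psi K psi)%:E)%E.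
Proof.
apply: le_trans (expectation_FDP_le _ _ FDP_term_le_kstar_eq) _ => //.
  by move=> i j; apply: measurableI => //; exact: measurableD.
rewrite lee_fin -mulrA [_^-1 * _]mulrC mulr_natl -sumr_const.
apply: ler_sum => i iN; rewrite big_add1 /=.
apply: (@le_trans _ _ (\sum_(0 <= j < K)
    z_psi K psi / K%:R * (g i j.+1 - g i j))).
  by apply: ler_sum_nat => j /andP[_ jK]; exact: prob_kstar_eq_le.
rewrite -mulr_sumr telescope_sumr// subr0 -[leRHS]mulr1.
rewrite ler_wpM2l ?divr_ge0 ?z_psi_ge0//.
suff g1 j : g i j <= 1 by [].
by case: j => [|j]; [exact: ler01|exact: cond_prob_le1].
Qed.

End PositiveDependence.
End ProcedureEvents.

Theorem proposition4 (R : realType) (d : measure_display)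
    (T : measurableType d) (P : probability T R)
    (K : nat) (K_ge1 : (1 <= K)%N) (N : {set 'I_K})
    (psi : R -> \bar R) (psi_dec : decreasing_transform psi)
    (X : 'I_K -> {RV P >-> R}) (X_pval : p_values N X) :
  ('E_P[fun w => FDP psi N (fun k => X k w)]
     <= (#|N|%:R / K%:R * y_psi K psi)%:E)%E
  /\
  (PRDS N X ->
   ('E_P[fun w => FDP psi N (fun k => X k w)]
      <= (#|N|%:R / K%:R * z_psi K psi)%:E)%E).
Proof.
split; first exact: expectation_FDP_le_y_psi.
exact: expectation_FDP_le_z_psi.
Qed.
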